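(* Let $-\infty<t_1<t_2<+\infty$, $z\in\mathbb C^{\rm up}$, $a\in(0,1)$. If $a|z|\ge\max\{|t_1|,|t_2|\}$, then $$\omega(z,[t_1,t_2])\ge(t_2-t_1)\,\frac{1-a}{8\pi}\operatorname{Im}\frac1{\bar z}.$$
   Context: $\mathbb C^{\rm up}=\{\operatorname{Im}z>0\}$. Harmonic measure of the upper half-plane: $\omega(z,B)=\frac1\pi\int_{B\cap\mathbb R}\frac{\operatorname{Im}z}{(t-\operatorname{Re}z)^2+(\operatorname{Im}z)^2}\,dt$ for $z\in\mathbb C^{\rm up}$ and Borel $B$. *)

(* Defs.v *)
From HB Require Import structures.
From mathcomp Require Import all_boot all_order all_algebra.
From mathcomp Require Import all_classical all_reals all_analysis.
From mathcomp Require Import complex.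

Set Implicit Arguments.
Unset Strict Implicit.
Unset Printing Implicit Defensive.

Import Order.TTheory GRing.Theory Num.Theory.
Import numFieldNormedType.Exports.

Local Open Scope classical_set_scope.
Local Open Scope ring_scope.
Local Open Scope complex_scope.

Definition upper_half_plane (R : realType) : set R[i] :=
  [set z | 0 < complex.Im z].

(* The integral is extended-real valued: as the integrand is nonnegative on the
   upper half-plane, no integrability convention enters. [B] is a set of complex
   numbers; only its trace on the real line matters. *)
Definition harmonic_measure (R : realType) (z : R[i]) (B : set R[i]) : \bar R :=
  ((pi^-1)%:E * \int[lebesgue_measure]_(t in [set t : R | B t%:C])
     (complex.Im z / ((t - complex.Re z) ^+ 2 + complex.Im z ^+ 2))%:E)%E.

(* Main.v *)
(** For [t] in [[t1, t2]] one has [|t| <= a |z| <= |z|], hence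
    [|t - z|^2 <= (2 |z|)^2], and the Poisson kernel at [t] is at least
    [Im z / (4 pi |z|^2)]; now integrate, and use [(1 - a) / 8 <= 1 / 4] and
    [Im (1 / conj z) = Im z / |z|^2]. *)

Require Import Defs.
From HB Require Import structures.
From mathcomp Require Import all_boot all_order all_algebra.
From mathcomp Require Import all_classical all_reals all_analysis.
From mathcomp Require Import complex.
From mathcomp Require Import measurable_realfun ring lra.

Import Order.TTheory GRing.Theory Num.Theory.
Import numFieldNormedType.Exports.

Local Open Scope classical_set_scope.
Local Open Scope ring_scope.
Local Open Scope complex_scope.

Lemma measurable_half_plane_poisson_kernel (R : realType) (D : set R) (x y : R) :
  0 < y -> measurable_fun D (fun t : R => y / ((t - x) ^+ 2 + y ^+ 2)).
Proof.
move=> y0; apply: measurable_funTS; apply: continuous_measurable_fun => t.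
apply: cvgM; first exact: cvg_cst.
apply: cvgV; first by rewrite gt_eqF // ltr_wpDl ?sqr_ge0 ?exprn_gt0.
apply: cvgD; last exact: cvg_cst.
by apply: (@continuous_comp _ _ _ (fun t : R => t - x) (fun t => t ^+ 2));
  [apply: cvgB; [exact: cvg_id|exact: cvg_cst]|exact: exprn_continuous].
Qed.

(** In [(t - x)^2 + (t + x)^2 = 2 t^2 + 2 x^2], dropping the square [(t + x)^2] and inserting the
    bound on [t^2] gives [(t - x)^2 + y^2 <= 4 x^2 + 3 y^2]. *)
Lemma half_plane_poisson_kernel_ge (R : realType) (x y t : R) :
  0 < y -> t ^+ 2 <= x ^+ 2 + y ^+ 2 ->
  y / (4 * (x ^+ 2 + y ^+ 2)) <= y / ((t - x) ^+ 2 + y ^+ 2).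
Proof.
move=> y0 tz; have y20 : 0 < y ^+ 2 by rewrite exprn_gt0.
have := sqr_ge0 x; have := sqr_ge0 (t - x); have := sqr_ge0 (t + x) => h1 h2 h3.
rewrite ler_pM2l // lef_pV2 ?posrE; [|lra..].
rewrite !expr2 in tz y20 h1 h2 h3 *; lra.
Qed.

Theorem mainTheorem11 (R : realType) (t1 t2 : R) (z : R[i]) (a : R)
  (ht : t1 < t2) (hz : upper_half_plane z) (ha0 : 0 < a) (ha1 : a < 1)
  (hmax : Num.max `|t1| `|t2| <= a * Normc.normc z) :
  (((t2 - t1) * ((1 - a) / (8 * pi)) * complex.Im (z^*%C)^-1)%:E
     <= harmonic_measure z [set t%:C | t in `[t1, t2]])%E.
Proof.
case: z hz hmax => x y; rewrite /upper_half_plane /= => y0 hmax.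
have y20 : 0 < y ^+ 2 by rewrite exprn_gt0.
have N0 : 0 < x ^+ 2 + y ^+ 2 by rewrite ltr_wpDl ?sqr_ge0.
rewrite /harmonic_measure /=.
(* The embedding of the reals is injective, so the trace of the embedded segment is the segment
   itself. *)
have -> : [set t : R | [set t0%:C | t0 in `[t1, t2]] t%:C] = [set` `[t1, t2]].
  apply/seteqP; split=> [t /= [s ts [<-]] //|t tt /=]; by exists t.
have tN t : t \in `[t1, t2] -> t ^+ 2 <= x ^+ 2 + y ^+ 2.
  rewrite in_itv /= => /andP[t1t tt2].
  have tz : `|t| <= Num.sqrt (x ^+ 2 + y ^+ 2).
    apply: (@le_trans _ _ (Num.max `|t1| `|t2|)).
      by rewrite le_max !ler_norml; have := ler_norm t2; have := ler_norm (- t1);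
        rewrite normrN; lra.
    by apply: le_trans hmax _; rewrite ler_piMl ?sqrtr_ge0 ?ltW.
  by rewrite -(sqr_sqrtr (ltW N0)) -(real_normK (num_real t)) lerXn2r ?nnegrE ?sqrtr_ge0.
set c := y / (4 * (x ^+ 2 + y ^+ 2)).
have c0 : 0 < c by rewrite divr_gt0 ?mulr_gt0.
apply: (@le_trans _ _ ((pi^-1)%:E * (c * (t2 - t1))%:E)%E).
  rewrite -EFinM lee_fin.
  (* The left side is the computed form of [Im (1 / conj z)]. *)
  have -> : - (- y / (x ^+ 2 + (- y) ^+ 2)) = 4 * c.
    by rewrite /c sqrrN; field; rewrite gt_eqF.
  have -> : (t2 - t1) * ((1 - a) / (8 * pi)) * (4 * c) =
      pi^-1 * (c * (t2 - t1) * ((1 - a) / 2)).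
    (* With [pi^-1] abstracted to a variable, [field] has no condition [pi != 0] to discharge. *)
    by rewrite invfM; move: (pi^-1) => p; field.
  (* The surplus factor [(1 - a) / 2] is at most 1 because [a] is positive. *)
  rewrite ler_wpM2l ?invr_ge0 ?pi_ge0 // ler_piMr; [by []| |lra].
  by rewrite mulr_ge0 ?ltW ?subr_gt0.
apply: lee_wpmul2l; first by rewrite lee_fin invr_ge0 pi_ge0.
have mI : lebesgue_measure ([set` `[t1, t2]] : set R) = (t2 - t1)%:E.
  by rewrite lebesgue_measure_itv /= lte_fin ht EFinB.
(* The lower bound becomes the integral of the constant [c], to be compared pointwise with the
   kernel. *)
rewrite EFinM -mI -integral_cst //.
apply: ge0_le_integral => //=.
- by move=> t _; rewrite lee_fin ltW.
- by apply/measurable_EFinP; exact: measurable_half_plane_poisson_kernel.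
- by move=> t /tN tz; rewrite lee_fin; exact: half_plane_poisson_kernel_ge.
Qed.
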